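(* Let $p_1,\dots,p_n\in(0,1]$. If $\mathbf{s}$ is the optimal threshold of the game $\mathcal{G}(p_1,\dots,p_n)$ and $R_{\mathbf{s}}=\infty$, then $$\mathcal{V}(p_1,\dots,p_n)\;\ge\;\left(\frac{n-\mathbf{s}}{n-\mathbf{s}+R_{\mathbf{s}+1}}\right)^{n-\mathbf{s}}\;>\;\frac{1}{e^{R_{\mathbf{s}+1}}}\;>\;\frac1e .$$
   Context: $\mathcal{G}(p_1,\dots,p_n)$ is the last-success game: independent Bernoulli variables $I_1,\dots,I_n$ ($n$ known) with $P(I_i=1)=p_i>0$ are observed sequentially, and the player wins if he stops on the last variable equal to $1$. Put $q_i=1-p_i$, $r_i=p_i/q_i$ (with $r_i=\infty$ if $p_i=1$), $R_k=\sum_{i=k}^n r_i\in[0,\infty]$ (empty sum $=0$). The optimal threshold is $\mathbf{s}=\max\{1\le k\le n: R_k\ge 1\}$ if $R_1\ge 1$, and $\mathbf{s}=1$ otherwise; it is optimal to stop on the first $1$ among $I_{\mathbf{s}},\dots,I_n$. The optimal win probability is $$\mathcal{V}(p_1,\dots,p_n)=\Big(\prod_{j=\mathbf{s}}^n q_j\Big)\Big(\sum_{i=\mathbf{s}}^n r_i\Big)\ \text{ if } p_{\mathbf{s}}<1,\qquad \mathcal{V}(p_1,\dots,p_n)=\prod_{j=\mathbf{s}+1}^n q_j\ \text{ if } p_{\mathbf{s}}=1$$ (empty product $=1$).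
   Formalization: When s = n the base is 0/0 and the middle strict inequality would read 1 > 1 (e.g. n = 1, p_1 = 1), so that strict inequality is claimed only for s < n; for s = n it is stated as ≥, with the zeroth power read as 1. *)

(* Defs.v *)
From mathcomp Require Import all_boot all_order all_algebra.
From mathcomp Require Import all_classical all_reals all_analysis.
From mathcomp Require Import ring.

Set Implicit Arguments.
Unset Strict Implicit.
Unset Printing Implicit Defensive.

Import Order.TTheory GRing.Theory Num.Theory.
Local Open Scope ring_scope.

(* The success probabilities are given by p : nat -> R, of which only
   p 1, ..., p n are relevant.  An outcome of the game is a tuple
   w : n.-tuple bool; since 'I_n counts from 0, the value of I_(i+1) is
   tnth w i, which is true with probability p i.+1. *)

Definition outcome_prob (R : realType) (n : nat) (p : nat -> R)
    (w : n.-tuple bool) : R :=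
  \prod_(i < n) (if tnth w i then p i.+1 else 1 - p i.+1).

(* tau w = Some i means that the player stops on the variable at position i,
   tau w = None that he never stops.  The event tau = Some i may only depend on
   the observations at positions 0, ..., i. *)
Definition stopping_rule (n : nat)
    (tau : {ffun n.-tuple bool -> option 'I_n}) : bool :=
  [forall w, forall w', forall i : 'I_n,
    (tau w == Some i) ==>
    [forall j : 'I_n, (j <= i)%N ==> (tnth w j == tnth w' j)] ==>
    (tau w' == Some i)].

Definition wins (n : nat) (tau : {ffun n.-tuple bool -> option 'I_n})
    (w : n.-tuple bool) : bool :=
  if tau w is Some i then
    tnth w i && [forall j : 'I_n, (i < j)%N ==> ~~ tnth w j]
  else false.

Definition win_prob (R : realType) (n : nat) (p : nat -> R)
    (tau : {ffun n.-tuple bool -> option 'I_n}) : R :=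
  \sum_(w : n.-tuple bool | wins tau w) outcome_prob p w.

(* There are finitely many stopping rules, so the supremum of the winning
   probabilities is a maximum; never stopping wins with probability 0. *)
Definition game_value (R : realType) (n : nat) (p : nat -> R) : R :=
  \big[Num.max/0]_(tau : {ffun n.-tuple bool -> option 'I_n}
                     | stopping_rule tau) win_prob p tau.

Definition odds (R : realType) (x : R) : \bar R :=
  if x == 1 then +oo%E else (x / (1 - x))%:E.

Definition odds_sum (R : realType) (n : nat) (p : nat -> R) (k : nat) : \bar R :=
  (\sum_(k <= i < n.+1) odds (p i))%E.

Definition threshold (R : realType) (n : nat) (p : nat -> R) : nat :=
  if (1 <= odds_sum n p 1)%E
  then \max_(1 <= k < n.+1 | (1 <= odds_sum n p k)%E) k
  else 1%N.

Definition odds_formula (R : realType) (n : nat) (p : nat -> R) : R :=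
  let s := threshold n p in
  if p s < 1
  then (\prod_(s <= j < n.+1) (1 - p j)) * (\sum_(s <= i < n.+1) p i / (1 - p i))
  else \prod_(s.+1 <= j < n.+1) (1 - p j).

Section OddsTheorem.
Variable R : realType.
Implicit Types (n k : nat) (p : nat -> R).

Let shift p : nat -> R := fun i => p i.+1.

(* Backward induction: after a success in first position the player compares
   stopping, which wins if all later variables are 0, with continuing. *)
Let dyn : nat -> (nat -> R) -> R :=
  fix dyn n p := if n is m.+1 then
    p 1%N * Num.max (\prod_(i < m) (1 - p i.+2)) (dyn m (shift p))
    + (1 - p 1%N) * dyn m (shift p) else 0.

Let sum_tupleS n (F : n.+1.-tuple bool -> R) :
  \sum_w F w = \sum_(w : n.-tuple bool) F [tuple of true :: w]
             + \sum_(w : n.-tuple bool) F [tuple of false :: w].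
Proof.
rewrite (reindex (fun bw : bool * n.-tuple bool => [tuple of bw.1 :: bw.2])) /=.
  rewrite -(pair_bigA _ (fun b (w : n.-tuple bool) => F [tuple of b :: w])) /=.
  by rewrite big_bool.
exists (fun w => (thead w, [tuple of behead w])) => [[b w] _|w _] /=.
  by congr (_, _); apply: val_inj.
by rewrite -tuple_eta.
Qed.

Let outcome_probS n p b (w : n.-tuple bool) :
  outcome_prob p [tuple of b :: w] =
  (if b then p 1%N else 1 - p 1%N) * outcome_prob (shift p) w.
Proof.
rewrite /outcome_prob big_ord_recl /= tnth0; congr (_ * _).
by apply: eq_bigr => i _; rewrite tnthS.
Qed.

Let probs n p := forall i, (1 <= i <= n)%N -> 0 <= p i <= 1.

Let probs_shift n p : probs n.+1 p -> probs n (shift p).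
Proof. by move=> h i /andP[_ le_in]; apply: h. Qed.

Let outcome_prob_ge0 n p (w : n.-tuple bool) :
  probs n p -> 0 <= outcome_prob p w.
Proof.
move=> h; apply: prodr_ge0 => i _.
have /andP[p0 p1] := h i.+1 (ltn_ord i).
by case: ifP => // _; rewrite subr_ge0.
Qed.

Let dyn_ge0 n p : probs n p -> 0 <= dyn n p.
Proof.
elim: n p => [|n IH] p h //=.
have d0 := IH _ (probs_shift h).
have /andP[p0 p1] := h 1%N isT.
by rewrite addr_ge0// mulr_ge0 ?subr_ge0// le_max d0 orbT.
Qed.

Let win_probE n p (tau : {ffun n.-tuple bool -> option 'I_n}) :
  win_prob p tau = \sum_w (wins tau w)%:R * outcome_prob p w.
Proof.
by rewrite /win_prob big_mkcond; apply: eq_bigr => w _; case: ifP;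
  rewrite ?mul1r ?mul0r.
Qed.

Let no_success n (w : n.-tuple bool) := [forall j : 'I_n, ~~ tnth w j].

Let forall_ordS n (P : pred 'I_n.+1) :
  [forall i, P i] = P ord0 && [forall i, P (lift ord0 i)].
Proof.
apply/forallP/andP => [h|[h0 /forallP h] i]; first by split=> //; apply/forallP.
by case: (unliftP ord0 i) => [j|] ->.
Qed.

Let sum_no_success n p :
  \sum_(w : n.-tuple bool) (no_success w)%:R * outcome_prob p w =
  \prod_(i < n) (1 - p i.+1).
Proof.
elim: n p => [|n IH] p.
  rewrite big_ord0 (big_pred1 [tuple]) /=; last first.
    by move=> w; apply/esym/eqP; exact: tuple0.
  rewrite /outcome_prob big_ord0 mulr1.
  by rewrite (_ : no_success _ = true)//; apply/forallP => -[].
rewrite sum_tupleS big_ord_recl -(IH (shift p)) big1 ?add0r => [|w _].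
  rewrite mulr_sumr; apply: eq_bigr => w _.
  rewrite outcome_probS mulrCA; congr (_ * (_%:R * _)).
  rewrite /no_success forall_ordS tnth0 /=.
  by congr (nat_of_bool _); apply: eq_forallb => i; rewrite tnthS.
by rewrite /no_success forall_ordS tnth0 mul0r.
Qed.

Let winsS0 n (tau : {ffun n.+1.-tuple bool -> option 'I_n.+1}) b
    (w : n.-tuple bool) :
  tau [tuple of b :: w] = Some ord0 ->
  wins tau [tuple of b :: w] = b && no_success w.
Proof.
rewrite /wins => ->; rewrite tnth0 forall_ordS /=.
by congr (_ && _); apply: eq_forallb => i; rewrite tnthS.
Qed.

Let winsS n (tau : {ffun n.+1.-tuple bool -> option 'I_n.+1})
    (sigma : {ffun n.-tuple bool -> option 'I_n}) b (w : n.-tuple bool) :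
  tau [tuple of b :: w] = omap (lift ord0) (sigma w) ->
  wins tau [tuple of b :: w] = wins sigma w.
Proof.
rewrite /wins => ->; case: (sigma w) => //= i.
rewrite tnthS forall_ordS /=.
by congr (_ && _); apply: eq_forallb => j; rewrite tnthS.
Qed.

Let stoppingP n (tau : {ffun n.-tuple bool -> option 'I_n}) :
  reflect (forall w w' i, tau w = Some i ->
      (forall j : 'I_n, (j <= i)%N -> tnth w j = tnth w' j) -> tau w' = Some i)
    (stopping_rule tau).
Proof.
apply: (iffP idP) => [/forallP h w w' i twi hj|h].
  move: (h w) => /forallP/(_ w')/forallP/(_ i).
  rewrite twi eqxx /= => /implyP H; apply/eqP/H/forallP => j.
  by apply/implyP => /hj ->.
apply/forallP => w; apply/forallP => w'; apply/forallP => i.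
apply/implyP => /eqP twi; apply/implyP => /forallP hj; apply/eqP.
by apply: h twi _ => j ji; have /implyP/(_ ji)/eqP := hj j.
Qed.

Let win_prob_le n p (tau : {ffun n.-tuple bool -> option 'I_n}) :
  probs n p -> stopping_rule tau -> win_prob p tau <= dyn n p.
Proof.
elim: n p tau => [|n IH] p tau h /stoppingP st.
  by rewrite /win_prob big1// => w; rewrite /wins; case: (tau w) => [[]|].
have d0 := dyn_ge0 (probs_shift h).
have /andP[p0 p1] := h 1%N isT.
have q0 : 0 <= 1 - p 1%N by rewrite subr_ge0.
have branch b : \sum_(w : n.-tuple bool) (wins tau [tuple of b :: w])%:R *
      outcome_prob p [tuple of b :: w] <=
    (if b then p 1%N else 1 - p 1%N) *
    (if b then Num.max (\prod_(i < n) (1 - p i.+2)) (dyn n (shift p))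
     else dyn n (shift p)).
  have c0 : 0 <= (if b then p 1%N else 1 - p 1%N) by case: b.
  under eq_bigr do rewrite outcome_probS mulrCA.
  rewrite -mulr_sumr; apply: ler_wpM2l => //.
  have [[w0 tw0]|ns] := pselect
      (exists w : n.-tuple bool, tau [tuple of b :: w] = Some ord0).
    have tw (w : n.-tuple bool) : tau [tuple of b :: w] = Some ord0.
      apply: st tw0 _ => j; rewrite leqn0 => /eqP j0.
      by rewrite (_ : j = ord0) ?tnth0//; apply: val_inj.
    under eq_bigr do rewrite winsS0//.
    case: b {c0 tw0 tw} => /=.
      by rewrite sum_no_success le_max lexx.
    by rewrite big1// => w _; rewrite mul0r.
  pose sigma := [ffun w : n.-tuple bool =>
    obind (unlift ord0) (tau [tuple of b :: w])].
  have tauE (w : n.-tuple bool) :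
      tau [tuple of b :: w] = omap (lift ord0) (sigma w).
    rewrite ffunE; case tw : (tau _) => [i|] //=.
    case: unliftP tw => [j ->|->] //= tw.
    by case: ns; exists w.
  under eq_bigr do rewrite (winsS (tauE _)).
  rewrite -win_probE.
  have ss : stopping_rule sigma.
    apply/stoppingP => w w' i sw hj.
    have := st [tuple of b :: w] [tuple of b :: w'] (lift ord0 i).
    rewrite !tauE sw => /(_ erefl); case: (sigma w') => [i'|] /= H.
      suff /Some_inj/lift_inj -> : Some (lift ord0 i') = Some (lift ord0 i) by [].
      apply: H => j; case: (unliftP ord0 j) => [k|] -> ji; last by rewrite !tnth0.
      by rewrite !tnthS; apply: hj; rewrite -ltnS.
    suff : None = Some (lift ord0 i) by [].
    apply: H => j; case: (unliftP ord0 j) => [k|] -> ji; last by rewrite !tnth0.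
    by rewrite !tnthS; apply: hj; rewrite -ltnS.
  apply: le_trans (IH _ _ (probs_shift h) ss) _.
  by case: b {c0 ns sigma tauE ss} => //; rewrite le_max lexx orbT.
rewrite win_probE sum_tupleS /=.
by apply: lerD; [exact: (branch true)|exact: (branch false)].
Qed.

Let win_prob_attained n p :
  exists2 tau : {ffun n.-tuple bool -> option 'I_n},
    stopping_rule tau & win_prob p tau = dyn n p.
Proof.
elim: n p => [|n IH] p.
  exists [ffun=> None]; first by apply/stoppingP => w w' [].
  by rewrite /win_prob big1// => w; rewrite /wins ffunE.
have [sigma /stoppingP ss sE] := IH (shift p).
pose stop := dyn n (shift p) <= \prod_(i < n) (1 - p i.+2).
pose tau := [ffun w : n.+1.-tuple bool => if stop && thead w then Some ord0
  else omap (lift ord0) (sigma [tuple of behead w])].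
have beheadE b (w : n.-tuple bool) : [tuple of behead [tuple of b :: w]] = w.
  exact: val_inj.
exists tau.
  apply/stoppingP => w w' i; rewrite !ffunE => + hj.
  have -> : thead w' = thead w by rewrite /thead -hj.
  case: ifP => // _; case sw : (sigma _) => [k|] //= /Some_inj ki.
  rewrite (ss _ [tuple of behead w'] _ sw) /= ?ki// => j jk.
  have := hj (lift ord0 j); rewrite -ki => /(_ jk).
  by rewrite {1}(tuple_eta w) {1}(tuple_eta w') !tnthS.
have tauF (w : n.-tuple bool) :
    tau [tuple of false :: w] = omap (lift ord0) (sigma w).
  by rewrite ffunE theadE andbF beheadE.
rewrite win_probE sum_tupleS /=; congr (_ + _); last first.
  under eq_bigr do rewrite (winsS (tauF _)) outcome_probS mulrCA.
  by rewrite -mulr_sumr -win_probE sE.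
case: (boolP stop) => hs.
  have tauT (w : n.-tuple bool) : tau [tuple of true :: w] = Some ord0.
    by rewrite ffunE theadE hs.
  under eq_bigr do rewrite (winsS0 (tauT _)) outcome_probS mulrCA.
  by rewrite -mulr_sumr /= sum_no_success max_l.
have tauT (w : n.-tuple bool) :
    tau [tuple of true :: w] = omap (lift ord0) (sigma w).
  by rewrite ffunE theadE (negbTE hs) beheadE.
under eq_bigr do rewrite (winsS (tauT _)) outcome_probS mulrCA.
rewrite -mulr_sumr -win_probE sE max_r//.
by rewrite leNgt; apply: contra hs => /ltW.
Qed.

Let game_value_dyn n p : probs n p -> game_value n p = dyn n p.
Proof.
move=> h; apply/eqP; rewrite eq_le; apply/andP; split.
  by apply: bigmax_le => [|tau st]; [exact: dyn_ge0|exact: win_prob_le].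
have [tau st <-] := win_prob_attained n p.
exact: le_bigmax_cond.
Qed.

Let odds_ge0 (x : R) : 0 < x <= 1 -> (0 <= odds x)%E.
Proof.
move=> /andP[x0 x1]; rewrite /odds; case: ifP => // _.
by rewrite lee_fin divr_ge0 ?subr_ge0// ltW.
Qed.

Let odds_sumS n p k : odds_sum n.+1 p k.+1 = odds_sum n (shift p) k.
Proof. by rewrite /odds_sum big_add1. Qed.

Let odds_sum_out n p k : (n < k)%N -> odds_sum n p k = 0%E.
Proof. by move=> nk; rewrite /odds_sum big_geq. Qed.

Let good n p := forall i, (1 <= i <= n)%N -> 0 < p i <= 1.

Let good_probs n p : good n p -> probs n p.
Proof. by move=> h i /h /andP[/ltW -> ->]. Qed.

Let good_shift n p : good n.+1 p -> good n (shift p).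
Proof. by move=> h i /andP[_ le_in]; apply: h. Qed.

Let odds_sum_ltn n p k : (k <= n)%N ->
  odds_sum n p k = (odds (p k) + odds_sum n p k.+1)%E.
Proof. by move=> kn; rewrite /odds_sum big_ltn. Qed.

Let odds_sum_ge0 n p k : good n p -> (0 < k)%N -> (0 <= odds_sum n p k)%E.
Proof.
move=> h k0; rewrite /odds_sum big_nat_cond; apply: sume_ge0 => i.
rewrite andbT => /andP[ki lt_in]; apply/odds_ge0/h.
by rewrite (leq_trans k0 ki) -ltnS.
Qed.

Let odds_sum_anti n p k l : good n p -> (0 < k <= l)%N ->
  (odds_sum n p l <= odds_sum n p k)%E.
Proof.
move=> h /andP[k0 kl]; rewrite -(subnK kl); elim: (l - k)%N => // d IH.
apply: le_trans IH; rewrite addSn.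
have [dn|dn] := leqP (d + k) n.
  rewrite (odds_sum_ltn _ dn) leeDr//; apply/odds_ge0/h.
  by rewrite dn (leq_trans k0) ?leq_addl.
by rewrite !odds_sum_out// ltnW.
Qed.

Let prob_lt1 n p k i : good n p -> (0 < k <= i)%N -> (i <= n)%N ->
  (odds_sum n p k < +oo)%E -> p i < 1.
Proof.
move=> h ki le_in; have /andP[k0 k_i] := ki.
have i0 := leq_trans k0 k_i.
have /andP[_ pi1] : 0 < p i <= 1 by apply: h; rewrite i0.
rewrite (lt_neqAle (p i)) pi1 andbT; apply: contraTneq => pi_eq1.
rewrite -leNgt; apply: le_trans (odds_sum_anti h ki).
rewrite odds_sum_ltn// /odds pi_eq1 eqxx addye//.
by rewrite gt_eqF// (lt_le_trans _ (odds_sum_ge0 h _))// ltNy0.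
Qed.

Let odds_sum_fin n p k :
  (forall i, (k <= i <= n)%N -> p i < 1) ->
  odds_sum n p k = (\sum_(k <= i < n.+1) p i / (1 - p i))%:E.
Proof.
move=> h; rewrite /odds_sum -sumEFin; apply: eq_big_nat => i ki.
by rewrite /odds lt_eqF// h.
Qed.

(* In particular odds_sum n p (threshold n p).+1 is always finite; when the
   threshold is n it is an empty sum, equal to 0. *)
Lemma thresholdP n p : (1 <= odds_sum n p 1)%E ->
  [/\ (1 <= threshold n p <= n)%N, (1 <= odds_sum n p (threshold n p))%E &
      forall k, (threshold n p < k)%N -> (odds_sum n p k < 1)%E].
Proof.
move=> R1; rewrite /threshold R1; set s := \max_(_ <= k < _ | _) k.
have le_s k : (0 < k <= n)%N -> (1 <= odds_sum n p k)%E -> (k <= s)%N.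
  move=> kn Rk; rewrite /s; apply: (@leq_bigmax_seq nat _ _ id) => //.
  by rewrite mem_index_iota.
have n0 : (0 < n)%N.
  by case: (n) R1 => //; rewrite odds_sum_out// leNgt lte01.
have s0 : (0 < s)%N by apply: le_s.
have : (s == 0)%N || ((s <= n)%N && (1 <= odds_sum n p s)%E).
  rewrite /s big_nat_cond; elim/big_ind: _ => // [x y hx hy|k].
    by rewrite /maxn; case: ifP.
  by move=> /andP[/andP[_ kn] ->]; rewrite -ltnS kn orbT.
rewrite eqn0Ngt s0 /= => /andP[sn Rs].
split; rewrite ?s0// => k sk; rewrite ltNge; apply/negP => Rk.
have [kn|nk] := leqP k n.
  by have := le_s k; rewrite kn (leq_ltn_trans _ sk)// leqNgt sk => /(_ isT Rk).
by move: Rk; rewrite odds_sum_out// leNgt lte01.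
Qed.

Let threshold1 n p : good n p -> (odds_sum n p 2 < 1)%E -> threshold n p = 1%N.
Proof.
move=> h R2; have [R1|R1] := boolP (1 <= odds_sum n p 1)%E; last first.
  by rewrite /threshold (negbTE R1).
have [/andP[s0 _] Rs _] := thresholdP R1.
apply/eqP; rewrite eqn_leq s0 andbT leqNgt; apply/negP => s1.
have := le_lt_trans (odds_sum_anti h (_ : (0 < 2 <= threshold n p)%N)) R2.
by rewrite s1 ltNge Rs => /(_ isT).
Qed.

Let thresholdS n p : good n.+1 p -> (1 <= odds_sum n.+1 p 2)%E ->
  threshold n.+1 p = (threshold n (shift p)).+1.
Proof.
move=> h R2.
have R1 : (1 <= odds_sum n.+1 p 1)%E by rewrite (le_trans R2)// odds_sum_anti.
have [/andP[t0 _] Rt ht] := thresholdP R1.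
move: (R2); rewrite odds_sumS => /thresholdP [_ Rs hs].
have [tlt|tlt|//] := ltngtP (threshold n.+1 p) (threshold n (shift p)).+1.
  by have := ht _ tlt; rewrite odds_sumS ltNge Rs.
case: (threshold n.+1 p) t0 Rt tlt => // t _; rewrite odds_sumS ltnS => Rt tlt.
by have := hs _ tlt; rewrite ltNge Rt.
Qed.

Let formulaS n p : good n.+1 p -> (1 <= odds_sum n.+1 p 2)%E ->
  odds_formula n.+1 p = odds_formula n (shift p).
Proof. by move=> h R2; rewrite /odds_formula thresholdS// !big_add1. Qed.

Let prod_ge0_le1 n p k l : good n p -> (0 < k)%N -> (l <= n.+1)%N ->
  0 <= \prod_(k <= j < l) (1 - p j) <= 1.
Proof.
move=> h k0 ln; rewrite big_nat_cond.
elim/big_ind: _ => [|x y /andP[x0 x1] /andP[y0 y1]|i]; first by rewrite ler01 lexx.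
  by rewrite mulr_ge0//= mulr_ile1.
rewrite andbT => /andP[ki il].
have /andP[p0 p1] : 0 < p i <= 1.
  by apply: h; rewrite (leq_trans k0 ki) -ltnS (leq_trans il).
by rewrite subr_ge0 p1 gerBl ltW.
Qed.

Let prod_le_formula n p : good n p -> (1 <= odds_sum n p 1)%E ->
  \prod_(1 <= j < n.+1) (1 - p j) <= odds_formula n p.
Proof.
move=> h R1; have [/andP[s0 sn] Rs hs] := thresholdP R1.
rewrite /odds_formula; set s := threshold n p in s0 sn Rs hs *.
have /= := hs s.+1 (ltnSn s) => Rs1.
case: ifPn => ps.
  have plt i : (s <= i <= n)%N -> p i < 1.
    move=> /andP[]; rewrite leq_eqVlt => /predU1P[<-//|si] le_in.
    apply: (@prob_lt1 n p s.+1) => //.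
    by rewrite (lt_trans Rs1)// ltry.
  rewrite (odds_sum_fin plt) lee_fin in Rs.
  rewrite (big_cat_nat _ (n := s))//=; last exact: leqW.
  have /andP[a0 a1] := prod_ge0_le1 h (leqnn 1) (leqW sn : (s <= n.+1)%N).
  have /andP[b0 b1] := prod_ge0_le1 h s0 (leqnn n.+1).
  apply: (@le_trans _ _ (\prod_(s <= j < n.+1) (1 - p j))).
    by rewrite ler_piMl.
  by rewrite ler_peMr.
rewrite (big_cat_nat _ (n := s.+1))//=.
have /andP[a0 a1] := prod_ge0_le1 h (leqnn 1) (sn : (s.+1 <= n.+1)%N).
have /andP[b0 b1] := prod_ge0_le1 h (ltn0Sn s) (leqnn n.+1).
by rewrite ler_piMl.
Qed.

Let dyn_formula n p : good n.+1 p -> dyn n.+1 p = odds_formula n.+1 p.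
Proof.
elim: n p => [|n IH] p h.
  have R2 : (odds_sum 1 p 2 < 1)%E by rewrite odds_sum_out// lte01.
  have /andP[p0 p1] := h 1%N isT.
  rewrite /odds_formula threshold1// /= big_ord0 max_l ?ler01// mulr0 addr0 mulr1.
  rewrite !big_nat1 big_geq//; case: ltP => [p1'|p1'].
    by rewrite mulrC divfK// gt_eqF// subr_gt0.
  by apply/eqP; rewrite eq_le p1.
have hS := good_shift h.
have QE : \prod_(i < n.+1) (1 - p i.+2) = \prod_(1 <= j < n.+2) (1 - shift p j).
  by rewrite big_add1 big_mkord.
rewrite -[LHS]/(p 1%N * Num.max (\prod_(i < n.+1) (1 - p i.+2))
    (dyn n.+1 (shift p)) + (1 - p 1%N) * dyn n.+1 (shift p)) QE (IH _ hS).
have [R2|R2] := leP 1%E (odds_sum n.+2 p 2).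
  rewrite (formulaS h R2) max_r; last by rewrite prod_le_formula// -odds_sumS.
  by rewrite -mulrDl addrC subrK mul1r.
have R1' : (odds_sum n.+1 (shift p) 1 < 1)%E by rewrite -odds_sumS.
have thr1 : threshold n.+1 (shift p) = 1%N.
  by rewrite /threshold leNgt R1'.
have plt i : (1 <= i <= n.+1)%N -> shift p i < 1.
  move=> /andP[i0 le_in]; apply: (@prob_lt1 n.+1 (shift p) 1) => //.
  by rewrite (lt_trans R1')// ltry.
rewrite (odds_sum_fin plt) lte_fin in R1'.
rewrite {1 2}/odds_formula thr1 plt//.
rewrite /odds_formula threshold1//.
rewrite (@big_ltn _ _ _ 1 n.+3)// (@big_ltn _ _ _ 1 n.+3)// !(@big_add1 _ _ _ 1 n.+3) /=.
set Q := \prod_(1 <= j < _) _ in R1' *.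
set S := \sum_(1 <= j < _) _ in R1' *.
have /andP[Q0 _] : 0 <= Q <= 1 by apply: prod_ge0_le1 hS _ _.
rewrite max_l; last by rewrite ler_piMr// ltW.
have /andP[_ p1] := h 1%N isT.
case: ltP => p1'.
  have q0 : 1 - p 1%N != 0 by rewrite gt_eqF// subr_gt0.
  by rewrite -/Q -/S; field.
have -> : p 1%N = 1 by apply/eqP; rewrite eq_le p1.
by rewrite subrr mul0r addr0 mul1r.
Qed.

Lemma game_valueE n p : (0 < n)%N ->
  (forall i, (1 <= i <= n)%N -> 0 < p i <= 1) ->
  game_value n p = odds_formula n p.
Proof.
by case: n => // n _ h; rewrite game_value_dyn ?dyn_formula//; apply: good_probs.
Qed.

End OddsTheorem.

(* Main.v *)
(** If the sum is infinite at the threshold s but below 1 right after it, then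
    p_s = 1 and p_j < 1 for j > s, so the value of the game is the product of
    the q_j = 1 / (1 + r_j) over j > s.  By AM-GM the product of the 1 + r_j is
    at most (1 + R_{s+1} / (n - s))^(n - s), which is less than e^{R_{s+1}} as
    1 + x < e^x for x <> 0. *)
Require Import Defs.
From mathcomp Require Import all_boot all_order all_algebra.
From mathcomp Require Import all_classical all_reals all_analysis.

Import Order.TTheory GRing.Theory Num.Theory.
Local Open Scope ring_scope.

(** AM-GM for the numbers 1 / (1 - x_i) = 1 + x_i / (1 - x_i), with both sides inverted. *)
Lemma AGM_prod_subr (F : realFieldType) (m : nat) (x : 'I_m -> F) :
  (forall i, x i < 1) ->
  (m%:R / (m%:R + \sum_i x i / (1 - x i))) ^+ m <= \prod_i (1 - x i).
Proof.
move=> x1; have q0 i : 0 < 1 - x i by rewrite subr_gt0.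
have -> : m%:R + \sum_i x i / (1 - x i) = \sum_i (1 - x i)^-1.
  rewrite -[in m%:R](card_ord m) -sumr_const -big_split /=.
  apply: eq_bigr => i _; rewrite -[X in X + _](divff (lt0r_neq0 (q0 i))) -mulrDl.
  by rewrite subrK div1r.
have V0 i : 0 <= (1 - x i)^-1 by rewrite invr_ge0 ltW.
have [AGM _] := @leif_AGM F 'I_m predT (fun i => (1 - x i)^-1) (fun i _ => V0 i).
rewrite cardT size_enum_ord prodfV in AGM.
have P0 : 0 < \prod_i (1 - x i) by rewrite prodr_gt0.
(* Positivity of the power of the mean comes from AM-GM itself; this covers m = 0, where the mean is
   0 / 0 = 0 but its power is 1. *)
have M0 := lt_le_trans (_ : 0 < (\prod_i (1 - x i))^-1) AGM.
by rewrite -invf_div exprVn -[leRHS]invrK lef_pV2 ?posrE ?invr_gt0 ?M0 ?invr_gt0.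
Qed.

(** Inverting reduces this to (1 + x / m)^m < (e^(x / m))^m. *)
Lemma expR_inv_lt_pow (R : realType) (m : nat) (x : R) : (0 < m)%N -> 0 < x ->
  (expR x)^-1 < (m%:R / (m%:R + x)) ^+ m.
Proof.
move=> m0 x0; have m0R : 0 < m%:R :> R by rewrite ltr0n.
rewrite -invf_div exprVn ltf_pV2 ?posrE ?expR_gt0 ?exprn_gt0 ?divr_gt0 ?addr_gt0//.
have xE : x = m%:R * (x / m%:R) by rewrite mulrC divfK// gt_eqF.
rewrite {2}xE expRM_natl ltrXn2r -?lt0n// ?divr_ge0 ?addr_ge0 ?ltW//.
by rewrite mulrDl divff ?gt_eqF// expR_gt1Dx// mulf_neq0 ?invr_eq0 ?gt_eqF.
Qed.

(** No term is -oo, so the sum is +oo exactly when some term is. *)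
Lemma odds_sum_eqyP (R : realType) (n : nat) (p : nat -> R) (k : nat) :
  odds_sum n p k = +oo%E <-> exists2 i, (k <= i <= n)%N & p i = 1.
Proof.
have oddsN i : true -> odds (p i) != -oo%E by rewrite /odds; case: ifP.
have oddsy i : odds (p i) = +oo%E <-> p i = 1.
  by rewrite /odds; split=> [|->]; [case: eqP|rewrite eqxx].
rewrite /odds_sum; split => [/(esum_eqyP _ oddsN)[i []]|[i kin pi1]].
  by rewrite mem_index_iota ltnS => kin _ /oddsy pi1; exists i.
apply/(esum_eqyP _ oddsN); exists i.
by rewrite mem_index_iota ltnS kin; split=> //; apply/oddsy.
Qed.

Lemma fine_odds_sum (R : realType) (n : nat) (p : nat -> R) (k : nat) :
  (forall i, (k <= i <= n)%N -> p i < 1) ->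
  odds_sum n p k = (\sum_(k <= i < n.+1) p i / (1 - p i))%:E.
Proof.
move=> p1; rewrite /odds_sum -sumEFin; apply: eq_big_nat => i ki.
by rewrite /odds lt_eqF// p1.
Qed.

(** The strict middle inequality is restricted to s < n: for s = n, [rho] = 0 and both sides equal
    1, since 0^0 = 1. *)
Theorem theorem5 (R : realType) (n : nat) (p : nat -> R)
  (hp : forall i : nat, (1 <= i <= n)%N -> 0 < p i <= 1)
  (hs : odds_sum n p (threshold n p) = +oo%E) :
  let s := threshold n p in
  let rho : R := fine (odds_sum n p s.+1) in
  let bound : R := ((n - s)%:R / ((n - s)%:R + rho)) ^+ (n - s) in
  [/\ bound <= game_value n p,
      (expR rho)^-1 <= bound,
      ((s < n)%N -> (expR rho)^-1 < bound) &
      (expR 1)^-1 < (expR rho)^-1].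
Proof.
move=> s rho bound.
(* Otherwise the threshold is the default 1, and [hs] makes R_1 < 1 infinite. *)
have R1 : (1 <= odds_sum n p 1)%E.
  rewrite leNgt; apply/negP => R1; have := hs.
  by rewrite /threshold leNgt R1 /= => R1y; rewrite R1y in R1.
have [/andP[s0 sn] _ /(_ _ (ltnSn s)) Rs1] := thresholdP R1.
have p01 i : (s < i <= n)%N -> 0 < p i < 1.
  move=> /andP[si le_in].
  have /andP[-> pi1] : 0 < p i <= 1 by apply: hp; rewrite (leq_ltn_trans _ si).
  rewrite lt_neqAle pi1 andbT; apply/eqP => pi_eq1.
  suff y : odds_sum n p s.+1 = +oo%E by rewrite y in Rs1.
  by apply/odds_sum_eqyP; exists i; rewrite ?si.
have ps : p s = 1.
  have [i /andP[]] := (odds_sum_eqyP _ n p s).1 hs.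
  rewrite leq_eqVlt => /predU1P[<-//|si] le_in pi1.
  by have := p01 i; rewrite si le_in pi1 ltxx andbF => /(_ isT).
have rhoE : odds_sum n p s.+1 = (\sum_(s.+1 <= i < n.+1) p i / (1 - p i))%:E.
  by apply: fine_odds_sum => i /p01/andP[].
have rho1 : rho < 1 by move: Rs1; rewrite /rho rhoE lte_fin.
have strict : (s < n)%N -> (expR rho)^-1 < bound.
  move=> lt_sn; apply: expR_inv_lt_pow; first by rewrite subn_gt0.
  (* As s < n, the sum has a term of index s + 1; it is positive, hence so is [rho]. *)
  rewrite /rho rhoE /= big_ltn//.
  have /andP[ps0 ps1] : 0 < p s.+1 < 1 by apply: p01; rewrite ltnSn.
  rewrite ltr_pwDl// ?divr_gt0 ?subr_gt0//.
  rewrite big_nat_cond sumr_ge0// => i; rewrite andbT ltnS => /andP[si le_in].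
  have /andP[p0 p1] : 0 < p i < 1 by apply: p01; rewrite le_in (ltnW si).
  by rewrite divr_ge0 ?subr_ge0// ltW.
split=> //.
- rewrite game_valueE ?(leq_trans s0 sn)// /odds_formula -/s ps ltxx.
  (* The shift i -> i + s + 1 turns the range s < j <= n into the n - s indices of ['I_(n - s)]. *)
  rewrite /bound /rho rhoE /= -(add0n s.+1) !big_addn subSS !big_mkord.
  apply: AGM_prod_subr => i; have /andP[] // : 0 < p (i + s.+1)%N < 1.
  by apply: p01; rewrite addnS ltnS leq_addl addnC -ltn_subRL ltn_ord.
- have [/strict/ltW//|le_ns] := ltnP s n.
  have ns : n = s by apply/eqP; rewrite eqn_leq le_ns.
  by rewrite /bound /rho rhoE ns big_geq// subnn expr0 expR0 invr1.
- by rewrite ltf_pV2 ?posrE ?expR_gt0// ltr_expR.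
Qed.
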